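(* Let $\Gamma^\nu$ and $\tilde\Gamma^{\tilde\nu}$, with $\nu,\tilde\nu\in\mathbb{Z}_+^\ell$, be two simplotopes that share a facet $\Gamma^{\nu-\epsilon}$, where $\epsilon\in\mathbb{Z}_+^\ell$ and $|\epsilon|=1$. Put $m=|\nu|+\ell-1$. Then there exist circumscribed simplices $\Delta^m$ of $\Gamma^\nu$ and $\tilde\Delta^m$ of $\tilde\Gamma^{\tilde\nu}$ such that $\Delta^m\cap\tilde\Delta^m=\Delta^{m-1}$, where $\Delta^{m-1}$ is a facet of both $\Delta^m$ and $\tilde\Delta^m$.
   Context: $\mathbb{Z}_+^\ell$ is the set of $\ell$-tuples of non-negative integers and $|\nu|=\sum_i\nu_i$. **Simplotope.** A $\nu$-simplotope is a product $\Gamma^\nu=\Delta_1\times\cdots\times\Delta_\ell$, where $\Delta_i$ is a simplex of dimension $\nu_i$ (possibly $0$) with vertices $\boldsymbol w_{i0},\dots,\boldsymbol w_{i\nu_i}\in\mathbb{R}^{|\nu|}$ and $\boldsymbol w_{i0}=\boldsymbol 0$. The simplices are affinely independent, so the product is the Minkowski sum and $\dim\Gamma^\nu=|\nu|$. Two simplotopes sharing a facet (a face of codimension $1$ that is identical for both) have equal dimension $|\nu|=|\tilde\nu|$ and lie in the same $\mathbb{R}^{|\nu|}$. The defining simplices are always chosen such that they share as many vertices as possible with those of the neighbouring simplotope. **Circumscribed simplex.** A circumscribed simplex of $\Gamma^\nu$ is an $m$-simplex $\Delta^m\subset\mathbb{R}^m$, $m=|\nu|+\ell-1$, whose vertex set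 can be partitioned into subsets $\mathcal V_i=\{\boldsymbol v_{i0},\dots,\boldsymbol v_{i\nu_i}\}$, $i=1,\dots,\ell$, such that $\Gamma^\nu=\Delta^m\cap\mathrm H_1\cap\cdots\cap\mathrm H_\ell$, where $\mathrm H_i=\{\boldsymbol b:\sum_j b_{ij}=\frac1\ell\}$ and $\boldsymbol b=(b_{ij})$, $\sum_{i,j}b_{ij}=1$, are barycentric coordinates with respect to the vertices $\boldsymbol v_{ij}$. Here $\mathbb{R}^{|\nu|}$ is regarded as the subset of $\mathbb{R}^m$ with the $\ell-1$ extra coordinates equal to zero. A circumscribed simplex of $\tilde\Gamma^{\tilde\nu}$ is defined likewise with $\tilde\nu$ in place of $\nu$, using the same embedding of $\mathbb{R}^{|\nu|}$.
   Formalization: The two simplotopes are assumed to meet exactly in the shared facet (their intersection equals it); without this the claim fails, e.g. for two equal simplotopes or two overlapping ones on the same side of the facet. *)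

(* Defs.v *)
From HB Require Import structures.
From mathcomp Require Import all_boot all_order all_algebra.
From mathcomp Require Import boolp classical_sets reals.

Set Implicit Arguments.
Unset Strict Implicit.
Unset Printing Implicit Defensive.

Import Order.TTheory GRing.Theory Num.Theory.

Local Open Scope classical_set_scope.
Local Open Scope ring_scope.

Definition affinely_independent (R : realType) (V : lmodType R) (I : finType)
    (v : I -> V) : Prop :=
  forall c : I -> R, \sum_i c i = 0 -> \sum_i c i *: v i = 0 ->
  forall i, c i = 0.

Definition convex_hull (R : realType) (V : lmodType R) (I : finType)
    (v : I -> V) : set V :=
  [set x | exists b : I -> R, [/\ forall i, 0 <= b i, \sum_i b i = 1
                                & x = \sum_i b i *: v i]].

Definition simplex (R : realType) (V : lmodType R) (k : nat) (S : set V)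
    : Prop :=
  exists v : 'I_k.+1 -> V, affinely_independent v /\ S = convex_hull v.

(* A (nonempty) polytope face: the contact set of a supporting hyperplane.
   The normal [a] may be 0, so [P] is a face of itself; a facet is a face
   whose dimension is one less than that of [P]. *)
Definition face (R : realType) (n : nat) (F P : set 'rV[R]_n) : Prop :=
  F !=set0 /\
  exists (a : 'cV[R]_n) (c : R),
    (forall x, P x -> (x *m a) 0 0 <= c) /\
    F = [set x | P x /\ (x *m a) 0 0 = c].

(* [w i] lists the vertices of the i-th factor. Independence of the factors:
   each [w i] is affinely independent and the directions of the factors are in
   direct sum. As all [w i 0] vanish, it says that the [w i j] with j > 0 are
   linearly independent, so that the polytope has dimension [\sum_i nu i].
   The ambient dimension [n] may be larger: faces of simplotopes are again
   simplotopes, in the same space. *)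
Definition factors_independent (R : realType) (V : lmodType R) (l : nat)
    (nu : 'I_l -> nat) (w : forall i, 'I_(nu i).+1 -> V) : Prop :=
  forall c : forall i, 'I_(nu i).+1 -> R,
    (forall i, \sum_j c i j = 0) -> \sum_i \sum_j c i j *: w i j = 0 ->
  forall i j, c i j = 0.

Definition minkowski_sum (R : realType) (V : lmodType R) (l : nat)
    (S : 'I_l -> set V) : set V :=
  [set x | exists y : 'I_l -> V, (forall i, S i (y i)) /\ x = \sum_i y i].

Definition simplotope (R : realType) (V : lmodType R) (l : nat)
    (nu : 'I_l -> nat) (G : set V) : Prop :=
  exists w : forall i, 'I_(nu i).+1 -> V,
    [/\ forall i, w i ord0 = 0,
        factors_independent w
      & G = minkowski_sum (fun i => convex_hull (w i))].

(* The points whose barycentric coordinates [b] with respect to the [v i j]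
   (stored at [Tagged _ j], of tag [i]) satisfy \sum_j b i j = 1 / l. *)
Definition bary_hyperplane (R : realType) (V : lmodType R) (l : nat)
    (nu : 'I_l -> nat) (v : {i : 'I_l & 'I_(nu i).+1} -> V) (i : 'I_l)
    : set V :=
  [set x | exists b : {i : 'I_l & 'I_(nu i).+1} -> R,
     [/\ \sum_k b k = 1, x = \sum_k b k *: v k
       & \sum_(k | tag k == i) b k = l%:R^-1]].

(* R^n as the subset of R^(n + l - 1) with vanishing last l - 1 coordinates. *)
Definition pad (R : realType) (l n : nat) (x : 'rV[R]_n) : 'rV[R]_(n + l.-1) :=
  row_mx x 0.

(* When n = \sum_i nu i and l > 0, the index type of [v] has n + l elements,
   so [D] is a simplex of full dimension n + l - 1. *)
Definition circumscribed (R : realType) (l n : nat) (nu : 'I_l -> nat)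
    (G : set 'rV[R]_n) (D : set 'rV[R]_(n + l.-1)) : Prop :=
  exists v : {i : 'I_l & 'I_(nu i).+1} -> 'rV[R]_(n + l.-1),
    [/\ affinely_independent v,
        D = convex_hull v
      & [set pad l x | x in G] = D `&` \bigcap_i bary_hyperplane v i].

(* Main.v *)
(* Placing the common vertex at the origin, a simplotope is the set of
   combinations [\sum_p c p *: u p] of linearly independent edges [u p], with
   [c >= 0] and coefficients of total at most 1 on each block of edges. This set
   determines its edges (a nonnegative matrix with nonnegative inverse is
   monomial) and its blocks (the sum of two edges belongs to it iff they lie in
   different blocks). Hence the facet [F] arises from both [G] and [G'] by
   dropping one edge, and the factors of [G] and [G'] match up to a permutation
   [s] of their indices.
   Let [T i] be the vertices of a simplex of R^(l-1) centred at 0. The points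
   [(l *: w i j, T i)] are the vertices of a circumscribed simplex of [G];
   translating the factors of [G'] by [T \o s^-1] makes all vertices but one
   coincide. The remaining two vertices are separated by the hyperplane spanned
   by the common ones, because [G] and [G'] lie on opposite sides of [F]. *)
Require Import Defs.
From HB Require Import structures.
From mathcomp Require Import all_boot all_order all_algebra.
From mathcomp Require Import boolp classical_sets reals.
From mathcomp Require Import lra perm.

Set Implicit Arguments.
Unset Strict Implicit.
Unset Printing Implicit Defensive.

Import Order.TTheory GRing.Theory Num.Theory.

Local Open Scope classical_set_scope.
Local Open Scope ring_scope.

(** * Corners: nonnegative combinations of independent edges, bounded on each block *)

Definition lin_indep (R : realType) (V : lmodType R) (P : finType)
    (u : P -> V) : Prop :=
  forall c : P -> R, \sum_p c p *: u p = 0 -> forall p, c p = 0.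

(** The map [f] labels each edge by its block. The slack in a block inequality is the weight of the
    common vertex 0 in that factor. *)
Definition corner (R : realType) (V : lmodType R) (P : finType) (L : eqType)
    (f : P -> L) (u : P -> V) : set V :=
  [set x | exists c : P -> R, [/\ forall p, 0 <= c p,
     forall i, \sum_(p | f p == i) c p <= 1 & x = \sum_p c p *: u p]].

Definition corner_on (R : realType) (V : lmodType R) (P : finType) (L : eqType)
    (A : pred P) (f : P -> L) (u : P -> V) : set V :=
  corner (fun p : {p | A p} => f (val p)) (fun p => u (val p)).

Section Corner.
Variables (R : realType) (V : lmodType R).
Implicit Types (P Q : finType) (L M : eqType).

Lemma sum_delta P (u : P -> V) p : \sum_q (q == p)%:R *: u q = u p.
Proof.
rewrite (bigD1 p) //= eqxx scale1r big1 ?addr0 // => q /negbTE ->.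
by rewrite scale0r.
Qed.

Lemma sum_delta_le1 P (A : pred P) p : \sum_(q | A q) (q == p)%:R <= 1 :> R.
Proof.
apply: (@le_trans _ _ (\sum_q (q == p)%:R)).
  by rewrite big_mkcond ler_sum // => q _; case: ifP => // _; rewrite ler0n.
rewrite (bigD1 p) //= eqxx big1 ?addr0 // => q /negbTE -> //.
Qed.

Lemma lin_indep_uniq P (u : P -> V) (c d : P -> R) : lin_indep u ->
  \sum_p c p *: u p = \sum_p d p *: u p -> c =1 d.
Proof.
move=> hu E p; apply/eqP; rewrite -subr_eq0; apply/eqP.
apply: (hu (fun p => c p - d p)).
under eq_bigr do rewrite scalerBl.
by rewrite sumrB E subrr.
Qed.

Lemma lin_indep_inj P (u : P -> V) : lin_indep u -> injective u.
Proof.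
move=> hu p q; rewrite -(sum_delta u p) -(sum_delta u q) => /(lin_indep_uniq hu).
move/(_ p); rewrite eqxx; case: eqP => // _ /eqP; by rewrite oner_eq0.
Qed.

(** Pushforward of weights along [h]: it carries coefficients from one family of vectors to another,
    preserving totals and, by [push_comb], combinations. *)
Definition push P Q (h : P -> Q) (c : P -> R) (q : Q) : R :=
  \sum_(p | h p == q) c p.

Lemma push_sum P Q (h : P -> Q) (c : P -> R) (B : pred Q) :
  \sum_(q | B q) push h c q = \sum_(p | B (h p)) c p.
Proof.
rewrite [RHS](partition_big h B) //=; apply: eq_bigr => q Bq.
by apply: eq_bigl => p; case: eqP => [->|_]; rewrite ?andbT ?andbF.
Qed.

Lemma push_comb P Q (h : P -> Q) (c : P -> R) (v : Q -> V) :
  \sum_q push h c q *: v q = \sum_p c p *: v (h p).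
Proof.
rewrite [RHS](partition_big h predT) //=; apply: eq_bigr => q _.
by rewrite scaler_suml; apply: eq_bigr => p /eqP <-.
Qed.

Lemma push_inj P Q (h : P -> Q) (c : P -> R) p : injective h ->
  push h c (h p) = c p.
Proof.
move=> hI; rewrite /push (eq_bigl (pred1 p)) ?big_pred1_eq // => q.
by rewrite /= (inj_eq hI).
Qed.

Lemma push_ge0 P Q (h : P -> Q) (c : P -> R) q :
  (forall p, 0 <= c p) -> 0 <= push h c q.
Proof. by move=> c0; apply: sumr_ge0. Qed.

Lemma lin_indep_comp P Q (h : P -> Q) (u : Q -> V) : injective h ->
  lin_indep u -> lin_indep (u \o h).
Proof.
move=> hI hu c hc p; rewrite -(push_inj c p hI); apply: hu.
by rewrite push_comb.
Qed.

Lemma affinely_independent_comp P Q (h : P -> Q) (v : Q -> V) : injective h ->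
  affinely_independent v -> affinely_independent (v \o h).
Proof.
move=> hI hv c c0 hc p; rewrite -(push_inj c p hI); apply: hv.
  by rewrite push_sum.
by rewrite push_comb.
Qed.

Lemma convex_hull_sub P Q (v : P -> V) (v' : Q -> V) :
  (forall p, exists q, v' q = v p) -> convex_hull v `<=` convex_hull v'.
Proof.
move=> /choice[h hE] x [b [b0 b1 ->]]; exists (push h b); split.
- by move=> q; apply: push_ge0.
- by rewrite push_sum.
- by rewrite push_comb; apply: eq_bigr => p _; rewrite hE.
Qed.

Lemma corner_comp_sub P Q L (h : P -> Q) (f : Q -> L) (u : Q -> V) :
  corner (f \o h) (u \o h) `<=` corner f u.
Proof.
move=> x [c [c0 c1 ->]]; exists (push h c); split.
- by move=> q; apply: push_ge0.
- by move=> i; rewrite push_sum; apply: c1.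
- by rewrite push_comb.
Qed.

Lemma big_subtype P (A : pred P) (W : nmodType) (F : P -> W) :
  \sum_(p | A p) F p = \sum_(p : {p | A p}) F (val p).
Proof. by rewrite -(big_sub (A : {pred P})). Qed.

Lemma big_sub_zero P (A B : pred P) (W : nmodType) (F : P -> W) :
  (forall p, ~~ A p -> F p = 0) ->
  \sum_(p | B p) F p = \sum_(p : {p | A p} | B (val p)) F (val p).
Proof.
move=> F0; rewrite -(big_sub_cond (A : {pred P})).
rewrite [LHS](bigID A) /= [X in _ + X]big1 ?addr0; last by move=> p /andP[_ /F0].
by apply: eq_bigl => p; rewrite andbC.
Qed.

Lemma corner_vertex P L (f : P -> L) (u : P -> V) p : corner f u (u p).
Proof.
exists (fun q => (q == p)%:R); split => [q|i|]; first by rewrite ler0n.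
  exact: sum_delta_le1.
by rewrite sum_delta.
Qed.

Lemma corner_coeff_le1 P L (f : P -> L) (c : P -> R) p :
  (forall p, 0 <= c p) -> (forall i, \sum_(p | f p == i) c p <= 1) -> c p <= 1.
Proof.
move=> c0 /(_ (f p)); apply: le_trans.
by rewrite (bigD1 p) //= lerDl sumr_ge0.
Qed.

(** Expanding [u p] in [u'] and each [u' q] in [u] gives nonnegative coefficients whose product is a
    row of the identity matrix. This makes some [u' q] a multiple of [u p], and the bound 1 on
    coefficients, used in both directions, makes the factor 1. *)
Lemma corner_edge P Q L M (f : P -> L) (g : Q -> M) (u : P -> V)
    (u' : Q -> V) p :
  lin_indep u -> lin_indep u' -> corner f u = corner g u' ->
  exists q, u' q = u p.
Proof.
move=> hu hu' E.
have: corner g u' (u p) by rewrite -E; apply: corner_vertex.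
move=> [B [B0 B1 BE]].
have /choice [A hA] q : exists A : P -> R,
    [/\ forall r, 0 <= A r, forall r, A r <= 1 & u' q = \sum_r A r *: u r].
  have: corner f u (u' q) by rewrite E; apply: corner_vertex.
  move=> [A [A0 A1 AE]]; exists A; split => // r.
  exact: corner_coeff_le1 A0 A1.
have AB : (fun r => \sum_q B q * A q r) =1 (fun r => (r == p)%:R).
  apply: (lin_indep_uniq hu); rewrite sum_delta BE.
  under eq_bigr do rewrite scaler_suml.
  rewrite exchange_big; apply: eq_bigr => q _ /=.
  have [_ _ ->] := hA q; rewrite scaler_sumr.
  by apply: eq_bigr => r _; rewrite scalerA.
have [q hq] : exists q, B q * A q p != 0.
  apply/existsP; apply: contraT; rewrite negb_exists => /forallP h.
  have := AB p; rewrite eqxx big1; last first.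
    by move=> q _; apply/eqP; move: (h q); rewrite negbK.
  by move/eqP; rewrite eq_sym oner_eq0.
have [A0 A1 AE] := hA q.
(* For [r != p] the nonnegative terms [B q * A q r] sum to 0, so each vanishes, while [B q] is
   nonzero. *)
have Ar r : r != p -> A q r = 0.
  move=> rp; have := AB r; rewrite (negbTE rp) => /psumr_eq0P h.
  have /eqP := h (fun q _ => mulr_ge0 (B0 q) (let: And3 a _ _ := hA q in a r)) q isT.
  rewrite mulf_eq0 => /orP[/eqP Bq|/eqP//].
  by rewrite Bq mul0r eqxx in hq.
have {}AE : u' q = A q p *: u p.
  by rewrite AE (bigD1 p) //= big1 ?addr0 // => r /Ar ->; rewrite scale0r.
have Ap : A q p != 0 by apply: contraNneq hq => ->; rewrite mulr0.
have Bq : B q = (A q p)^-1.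
  have /(_ q) : B =1 (fun r => (r == q)%:R / A q p).
    apply: (lin_indep_uniq hu'); rewrite -BE.
    under [RHS]eq_bigr do rewrite mulrC -scalerA.
    by rewrite -scaler_sumr sum_delta AE scalerA mulVf // scale1r.
  by rewrite eqxx mul1r.
exists q; rewrite AE.
suff -> : A q p = 1 by rewrite scale1r.
(* Both [A q p] and its inverse [B q] are at most 1. *)
apply/eqP; rewrite eq_le A1 /=.
have := corner_coeff_le1 q B0 B1; rewrite Bq invf_le1 //.
by rewrite lt_def Ap A0.
Qed.

Lemma corner_edge_bij P Q L M (f : P -> L) (g : Q -> M) (u : P -> V)
    (u' : Q -> V) :
  lin_indep u -> lin_indep u' -> corner f u = corner g u' ->
  exists h : P -> Q, bijective h /\ forall p, u' (h p) = u p.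
Proof.
move=> hu hu' E.
have /choice [h hE] p := corner_edge p hu hu' E.
have /choice [k kE] q := corner_edge q hu' hu (esym E).
exists h; split => //; exists k.
  by move=> p; apply: (lin_indep_inj hu); rewrite kE hE.
by move=> q; apply: (lin_indep_inj hu'); rewrite hE kE.
Qed.

(** By independence the only coefficients of [u p + u q] are two ones, which total 2 exactly when
    they fall in one block. *)
Lemma corner_addP P L (f : P -> L) (u : P -> V) p q : lin_indep u -> p != q ->
  corner f u (u p + u q) <-> f p != f q.
Proof.
move=> hu pq.
have uE : u p + u q = \sum_r ((r == p)%:R + (r == q)%:R) *: u r.
  under eq_bigr do rewrite scalerDl.
  by rewrite big_split /= !sum_delta.
split=> [[c [c0 c1 cE]]|fpq].
  apply/eqP => fE; move: cE; rewrite uE => /(lin_indep_uniq hu) cE.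
  have := c1 (f q); rewrite (bigD1 p) ?fE //= (bigD1 q) /=; last by rewrite eqxx eq_sym.
  rewrite -!cE !eqxx [q == p]eq_sym (negbTE pq) /=.
  have : 0 <= \sum_(i | (f i == f q) && (i != p) && (i != q)) c i by apply: sumr_ge0.
  move: (\sum_(_ | _) _) => s s0 h; clear -s0 h; lra.
exists (fun r => (r == p)%:R + (r == q)%:R); split => // [r|i].
  by rewrite addr_ge0 ?ler0n.
rewrite big_split /=.
have [fpi|fpi] := eqVneq (f p) i.
  rewrite [X in _ + X]big1 ?addr0 ?sum_delta_le1 // => r /eqP fr.
  by case: eqP => // rq; case/eqP: fpq; rewrite fpi -fr rq.
rewrite big1 ?add0r ?sum_delta_le1 // => r /eqP fr.
by case: eqP => // rq; case/eqP: fpi; rewrite -fr rq.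
Qed.

End Corner.

(** Induction on the size of [A]: after removing [a], the permutation [s] found is corrected by the
    transposition of [s a] and [f a], which by injectivity moves none of the other values [f x]. *)
Lemma extend_perm (T : finType) (A : {set T}) (f : T -> T) :
  {in A &, injective f} -> exists s : {perm T}, {in A, s =1 f}.
Proof.
have [m] := ubnP #|A|; elim: m A => // m IH A hA finj.
have [->|[a aA]] := set_0Vmem A.
  by exists 1%g => x; rewrite inE.
have [||s sE] := IH (A :\ a)%SET.
- by rewrite (cardsD1 a) aA in hA.
- by move=> x y /setD1P[_ xA] /setD1P[_ yA]; apply: finj.
exists (s * tperm (s a) (f a))%g => x xA; rewrite permM.
have [->|xa] := eqVneq x a; first by rewrite tpermL.
have sx : s x = f x by rewrite sE // !inE xa.
rewrite -sx tpermD //.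
  by rewrite (inj_eq perm_inj) eq_sym.
by rewrite sx; apply: contra_neq xa => /esym/(finj _ _ xA aA).
Qed.

(** * Linear functionals and spanning families *)

Section Functional.
Variables (R : realType) (n : nat).

Lemma functional_sum (P : finType) (A : pred P) (c : P -> R)
    (u : P -> 'rV[R]_n) (a : 'cV[R]_n) :
  ((\sum_(p | A p) c p *: u p) *m a) 0 0 = \sum_(p | A p) c p * (u p *m a) 0 0.
Proof.
rewrite mulmx_suml summxE; apply: eq_bigr => p _.
by rewrite -scalemxAl mxE.
Qed.

Lemma lin_indep_span (P : finType) (u : P -> 'rV[R]_n) :
  lin_indep u -> #|P| = n ->
  forall x, exists c : P -> R, x = \sum_p c p *: u p.
Proof.
move=> hu hP x; pose A := \matrix_(i < #|P|) u (enum_val i).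
have sumE (d : 'rV[R]_#|P|) : d *m A = \sum_p d 0 (enum_rank p) *: u p.
  rewrite mulmx_sum_row (reindex (@enum_rank P)) /=.
    by apply: eq_bigr => p _; rewrite rowK enum_rankK.
  exact/onW_bij/enum_rank_bij.
have : row_free A.
  rewrite -kermx_eq0; apply/rowV0P => d /sub_kermxP.
  rewrite sumE => /(hu (fun p => d 0 (enum_rank p))) d0.
  by apply/rowP => i; rewrite mxE -(d0 (enum_val i)) enum_valK.
rewrite /row_free => /eqP rA.
have : row_full A by rewrite /row_full rA hP.
move=> /(submx_full x) /submxP[d ->]; rewrite sumE.
by exists (fun p => d 0 (enum_rank p)).
Qed.
End Functional.

(** * Faces and facets of corners *)

Section Faces.
Variables (R : realType) (n : nat).

Lemma corner0 (V : lmodType R) (P : finType) (L : eqType) (f : P -> L)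
  (u : P -> V) : corner f u 0.
Proof.
exists (fun=> 0); split => // [i|]; first by rewrite big1.
by rewrite big1 // => p _; rewrite scale0r.
Qed.

(** With coefficients this small even the total over all edges is at most 1, whatever the blocks
    are. *)
Lemma corner_small (V : lmodType R) (P : finType) (L : eqType) (f : P -> L)
    (u : P -> V) (c : P -> R) :
  (forall p, 0 <= c p <= #|P|%:R^-1) -> corner f u (\sum_p c p *: u p).
Proof.
move=> hc; exists c; split => // [p|i]; first by case/andP: (hc p).
apply: (@le_trans _ _ (\sum_(p : P) #|P|%:R^-1)).
  rewrite big_mkcond ler_sum // => p _; case: ifP => _; first by case/andP: (hc p).
  by rewrite invr_ge0 ler0n.
rewrite sumr_const -[X in X *+ _]mul1r -mulrnAr -mulr_natl mul1r.
(* For empty [P] the inverse of 0 is 0, and the product is 0. *)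
by have [->|P0] := eqVneq #|P| 0; rewrite ?mul0r // mulfV ?pnatr_eq0.
Qed.

(** The supporting hyperplane passes through 0 and the functional is nonpositive on every edge. A
    point of the corner lies on the hyperplane only if its coefficients vanish on the edges where
    the functional is negative. *)
Lemma corner_face (P : finType) (L : eqType) (f : P -> L) (u : P -> 'rV[R]_n)
    (F : set 'rV[R]_n) : face F (corner f u) -> F 0 ->
  exists a : 'cV[R]_n, (forall p, (u p *m a) 0 0 <= 0) /\
  F = corner_on (fun p => (u p *m a) 0 0 == 0) f u.
Proof.
move=> [_ [a [c [hle FE]]]] F0.
have c0 : c = 0 by move: F0; rewrite FE => -[_ <-]; rewrite mul0mx mxE.
rewrite {}c0 in hle FE.
have u0 p : (u p *m a) 0 0 <= 0 by apply/hle/corner_vertex.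
exists a; split => //; rewrite FE; apply/seteqP; split => x /=.
  move=> [[b [b0 b1 ->]]]; rewrite functional_sum => h.
  have bA p : ~~ ((u p *m a) 0 0 == 0) -> b p = 0.
    move=> up; have : - (b p * (u p *m a) 0 0) = 0.
      apply: (@psumr_eq0P _ _ predT (fun p => - (b p * (u p *m a) 0 0))) => //.
        by move=> q _; rewrite oppr_ge0 mulr_ge0_le0.
      by rewrite sumrN h oppr0.
    by move/eqP; rewrite oppr_eq0 mulf_eq0 (negbTE up) orbF => /eqP.
  exists (fun p => b (val p)); split => // [i|].
    by rewrite -(big_sub_zero (fun p => f p == i) bA); apply: b1.
  rewrite (big_sub_zero (A := fun p => (u p *m a) 0 0 == 0)) // => p /bA ->.
  by rewrite scale0r.
move=> hx; split; first exact: corner_comp_sub hx.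
case: hx => b [_ _ ->]; rewrite functional_sum big1 // => p _.
by rewrite (eqP (valP p)) mulr0.
Qed.

(** Matching the edges of the face with those of [u] annihilated by the normal [a] shows that there
    are [#|Q|] of the latter, so a single edge is left over. *)
Lemma corner_facet (P Q : finType) (L M : eqType) (f : P -> L) (g : Q -> M)
    (u : P -> 'rV[R]_n) (u' : Q -> 'rV[R]_n) :
  lin_indep u -> lin_indep u' -> #|P| = #|Q|.+1 ->
  face (corner g u') (corner f u) ->
  exists (p0 : P) (a : 'cV[R]_n), [/\ forall p, p != p0 -> (u p *m a) 0 0 = 0,
    (u p0 *m a) 0 0 < 0
  & corner g u' = corner_on (fun p => p != p0) f u].
Proof.
move=> hu hu' PQ /corner_face /(_ (corner0 g u')) [a [a0 FE]].
pose A p := (u p *m a) 0 0 == 0.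
have [h [hb _]] := corner_edge_bij hu'
  (lin_indep_comp val_inj hu : lin_indep (fun p : {p | A p} => u (val p))) FE.
have cA : #|[predC A]| = 1%N.
  have := cardC A; rewrite PQ (bij_eq_card hb) card_sig -addn1 => /eqP.
  by rewrite eqn_add2l => /eqP.
have [p0 p0E] := mem_card1 cA.
have AE : A = (fun p => p != p0).
  by apply/funext => p; apply/negb_inj; rewrite negbK; apply: p0E.
exists p0, a; split.
- by move=> p pp0; apply/eqP; rewrite -/(A p) AE.
- by rewrite lt_neqAle a0 andbT -/(A p0) AE /= eqxx.
- by rewrite FE -/A AE.
Qed.

(* A small multiple of the sum of the edges of the common facet, pushed slightly
   in the direction of the extra edge of the second polytope, would otherwise be
   a common point outside the facet. *)
Lemma corner_opposite (P Q : finType) (L M : eqType) (f : P -> L) (g : Q -> M)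
    (u : P -> 'rV[R]_n) (u' : Q -> 'rV[R]_n) (p0 : P) (q0 : Q) (a : 'cV[R]_n) :
  lin_indep u -> lin_indep u' -> #|P| = n -> #|Q| = n ->
  let FP := corner_on (fun p => p != p0) f u in
  let FQ := corner_on (fun q => q != q0) g u' in
  FP = FQ -> corner f u `&` corner g u' = FP ->
  (forall p, p != p0 -> (u p *m a) 0 0 = 0) -> (u p0 *m a) 0 0 < 0 ->
  0 < (u' q0 *m a) 0 0.
Proof.
move=> hu hu' cP cQ FP FQ FE GE a0 ap0; rewrite ltNge; apply/negP => aq0.
have [al alE] := lin_indep_span hu cP (u' q0).
have alp0 : 0 <= al p0.
  move: aq0; rewrite alE functional_sum (bigD1 p0) //= big1 ?addr0; last first.
    by move=> p /a0 ->; rewrite mulr0.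
  by rewrite nmulr_lle0.
have n0 : 0 < n%:R :> R by rewrite ltr0n -cP; apply/card_gt0P; exists p0.
(* The choices of [s] and [d] give [d <= s] and [|d * al p| <= s], so the coefficients of [y] below
   lie between 0 and [s + s], that is 1/n, in both bases. At [p0] this uses [0 <= al p0]. *)
pose s : R := n%:R^-1 / 2.
have s0 : 0 < s by rewrite divr_gt0 // invr_gt0.
have s2 : n%:R^-1 = s + s by rewrite /s -splitr.
pose K := 1 + \sum_p `|al p|.
have K1 : 1 <= K by rewrite lerDl sumr_ge0.
have K0 : 0 < K by apply: lt_le_trans K1.
pose d := s / K.
have d0 : 0 < d by rewrite divr_gt0.
have ds : d <= s by rewrite ler_pdivrMr // ler_peMr // ltW.
have dal p : `|d * al p| <= s.
  rewrite normrM gtr0_norm // /d mulrAC ler_pdivrMr // ler_wpM2l ?(ltW s0) //.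
  by rewrite /K (bigD1 p) //= addrCA lerDl addr_ge0 // sumr_ge0.
have [h [hb hE]] := corner_edge_bij
  (lin_indep_comp val_inj hu : lin_indep (fun p : {p | p != p0} => u (val p)))
  (lin_indep_comp val_inj hu' : lin_indep (fun q : {q | q != q0} => u' (val q))) FE.
have sumE : \sum_(p | p != p0) u p = \sum_(q | q != q0) u' q.
  rewrite [LHS]big_subtype [RHS]big_subtype.
  rewrite [RHS](reindex h) /=; last exact: onW_bij.
  by apply: eq_bigr => p _; rewrite -[LHS]hE.
pose y := s *: (\sum_(q | q != q0) u' q) + d *: u' q0.
pose c q := if q == q0 then d else s.
have yQ : y = \sum_q c q *: u' q.
  rewrite [RHS](bigD1 q0) //= /c eqxx addrC /y scaler_sumr; congr (_ + _).
  by apply: eq_bigr => q /negbTE ->.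
have yG' : corner g u' y.
  rewrite yQ; apply: corner_small => q; rewrite cQ s2 /c.
  by case: eqP => _; lra.
have yG : corner f u y.
  have -> : y = \sum_p ((if p == p0 then 0 else s) + d * al p) *: u p.
    under eq_bigr do rewrite scalerDl -scalerA.
    rewrite big_split /= -scaler_sumr -alE; congr (_ + _).
    rewrite -sumE scaler_sumr [RHS](bigD1 p0) //= eqxx scale0r add0r.
    by apply: eq_bigr => p /negbTE ->.
  apply: corner_small => p; rewrite cP s2.
  have := dal p; rewrite ler_norml.
  by case: eqP => [->|_] /andP[h1 h2]; first have := mulr_ge0 (ltW d0) alp0; lra.
(* Membership in the facet forces the coefficient of [u' q0] to be 0, but it is [d]. *)
have : FQ y by rewrite -FE -GE.
case=> b [_ _]; rewrite yQ.
rewrite -(push_comb val b u') => /(lin_indep_uniq hu')/(_ q0).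
rewrite /c eqxx /push big1 => [dE|q /eqP vq]; first by rewrite dE ltxx in d0.
by have := valP q; rewrite vq eqxx.
Qed.

End Faces.

(** * Sums over tagged indices *)

Section Tagged.
Variables (W : nmodType) (I : finType) (T_ : I -> finType).

Lemma big_tag (F : {i : I & T_ i} -> W) i :
  \sum_(p | tag p == i) F p = \sum_j F (existT T_ i j).
Proof.
pose G i j := F (existT T_ i j).
transitivity (\sum_(k | k == i) \sum_j G k j); last by rewrite big_pred1_eq.
rewrite sig_big_dep; apply: eq_big => [p|[k j] _ //]; by rewrite andbT.
Qed.

Lemma big_tagged (F : {i : I & T_ i} -> W) :
  \sum_p F p = \sum_i \sum_j F (existT T_ i j).
Proof.
rewrite (partition_big tag predT) //=; apply: eq_bigr => i _.
exact: big_tag.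
Qed.

End Tagged.

(** * Simplotopes as corners *)

Section Simplotopes.
Variables (R : realType) (V : lmodType R) (l : nat) (nu : 'I_l -> nat).
Variable w : forall i, 'I_(nu i).+1 -> V.
Arguments w : clear implicits.
Hypothesis w0 : forall i, w i ord0 = 0.
Hypothesis hw : factors_independent w.

Definition edge (p : {i : 'I_l & 'I_(nu i)}) : V :=
  w (tag p) (lift ord0 (tagged p)).

Lemma card_edges : #|{: {i : 'I_l & 'I_(nu i)}}| = (\sum_i nu i)%N.
Proof.
by rewrite card_tagged sumnE big_map big_enum /=; apply: eq_bigr => i _;
   rewrite card_ord.
Qed.

Lemma edge_sum (c : {i : 'I_l & 'I_(nu i)} -> R) :
  \sum_p c p *: edge p =
  \sum_i \sum_(j < nu i) c (existT _ i j) *: w i (lift ord0 j).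
Proof. exact: big_tagged. Qed.

(* Extends coefficients on the edges to all vertices of the factors, with block
   sums [s]; the coefficient at the origin is irrelevant to the combination. *)
Definition complete (s : R) (c : {i : 'I_l & 'I_(nu i)} -> R) i
    (j : 'I_(nu i).+1) :=
  if unlift ord0 j is Some j' then c (existT _ i j')
  else s - \sum_(j < nu i) c (existT _ i j).

Lemma complete_lift s c i (j : 'I_(nu i)) :
  complete s c (lift ord0 j) = c (existT _ i j).
Proof. by rewrite /complete liftK. Qed.

Lemma complete_sum s c i : \sum_j complete s c (i := i) j = s.
Proof.
rewrite big_ord_recl; under eq_bigr do rewrite complete_lift.
by rewrite /complete unlift_none subrK.
Qed.

Lemma factor_comb i (c : 'I_(nu i).+1 -> R) :
  \sum_j c j *: w i j = \sum_j c (lift ord0 j) *: w i (lift ord0 j).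
Proof. by rewrite big_ord_recl w0 scaler0 add0r. Qed.

Lemma complete_comb s c :
  \sum_i \sum_j complete s c (i := i) j *: w i j = \sum_p c p *: edge p.
Proof.
rewrite edge_sum; apply: eq_bigr => i _; rewrite factor_comb.
by apply: eq_bigr => j _; rewrite complete_lift.
Qed.

(** Completing with block sums 0 turns a linear relation between edges into one to which
    [factors_independent] applies. *)
Lemma lin_indep_edge : lin_indep edge.
Proof.
move=> c hc [i j]; rewrite -(complete_lift 0); apply: hw.
  by move=> k; rewrite complete_sum.
by rewrite complete_comb.
Qed.

(** Dropping the weight of the origin in each factor leaves block sums at most 1; [complete 1]
    restores that weight, nonnegative by the same bound. *)
Lemma minkowski_corner :
  minkowski_sum (fun i => convex_hull (w i)) = corner tag edge.
Proof.
apply/seteqP; split=> x.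
  move=> [y [hy ->]].
  (* The type of the weights depends on [i], so they are extracted pointwise by [cid]. *)
  pose b i := projT1 (cid (hy i)).
  have hb i : [/\ forall j, 0 <= b i j, \sum_j b i j = 1 & y i = \sum_j b i j *: w i j].
    exact: (projT2 (cid (hy i))).
  exists (fun p => b (tag p) (lift ord0 (tagged p))); split.
  - by move=> [i j]; have [-> _ _] := hb i.
  - move=> i; rewrite big_tag /=; have [b0 <- _] := hb i.
    by rewrite big_ord_recl lerDr.
  - rewrite edge_sum; apply: eq_bigr => i _; have [_ _ ->] := hb i.
    exact: factor_comb.
move=> [c [c0 c1 ->]].
exists (fun i => \sum_j complete 1 c (i := i) j *: w i j); split; last first.
  by rewrite complete_comb.
move=> i; exists (complete 1 c (i := i)); split => // [j|]; last exact: complete_sum.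
rewrite /complete; case: unliftP => [j' _|_]; first exact: c0.
by rewrite subr_ge0; have := c1 i; rewrite big_tag.
Qed.

End Simplotopes.

(** * Simplices and their facets as convex hulls *)

Section Hulls.
Variable R : realType.

Lemma convex_hull_vertex (V : lmodType R) (K : finType) (v : K -> V) k :
  convex_hull v (v k).
Proof.
exists (fun q => (q == k)%:R); split => [q||]; first by rewrite ler0n.
  by rewrite (bigD1 k) //= eqxx big1 ?addr0 // => q /negbTE ->.
by rewrite sum_delta.
Qed.

Lemma simplex_hull (V : lmodType R) (K : finType) (v : K -> V) m :
  affinely_independent v -> #|K| = m.+1 -> simplex m (convex_hull v).
Proof.
move=> hv cK; pose h (j : 'I_m.+1) : K := enum_val (cast_ord (esym cK) j).
have hI : injective h by move=> i j /enum_val_inj/cast_ord_inj.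
exists (v \o h); split; first exact: affinely_independent_comp.
apply/seteqP; split; apply: convex_hull_sub => k; last by exists (h k).
by exists (cast_ord cK (enum_rank k)); rewrite /= /h cast_ordK enum_rankK.
Qed.

(** On the hull the functional equals the weight of [v k0] times a negative number, so it vanishes
    exactly when that weight does. *)
Lemma hull_supporting n (K : finType) (v : K -> 'rV[R]_n) (a : 'cV[R]_n) k0 :
  (forall k, k != k0 -> (v k *m a) 0 0 = 0) -> (v k0 *m a) 0 0 < 0 ->
  (forall x, convex_hull v x -> (x *m a) 0 0 <= 0) /\
  convex_hull (fun k : {k | k != k0} => v (val k)) =
    [set x | convex_hull v x /\ (x *m a) 0 0 = 0].
Proof.
move=> a0 ak0.
have aE (b : K -> R) : ((\sum_k b k *: v k) *m a) 0 0 = b k0 * (v k0 *m a) 0 0.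
  rewrite functional_sum (bigD1 k0) //= big1 ?addr0 // => k /a0 ->.
  by rewrite mulr0.
split; first by move=> x [b [b0 _ ->]]; rewrite aE mulr_ge0_le0 // ltW.
apply/seteqP; split=> x /=.
  move=> hx; split; first by apply: convex_hull_sub hx => k; exists (val k).
  case: hx => b [_ _ ->]; rewrite functional_sum big1 // => k _.
  by rewrite a0 ?mulr0 // (valP k).
move=> [[b [b0 b1 ->]]]; rewrite aE => /eqP; rewrite mulf_eq0 (lt_eqF ak0) orbF.
move=> /eqP bk0.
have bz k : ~~ (k != k0) -> b k = 0 by rewrite negbK => /eqP ->.
exists (fun k => b (val k)); split => //.
  by rewrite -b1 [RHS](big_sub_zero xpredT bz).
by rewrite (big_sub_zero (A := fun k => k != k0)) // => k /bz ->; rewrite scale0r.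
Qed.

End Hulls.

(** * Construction of a circumscribed simplex *)

Section Circumscribed.
Variables (R : realType) (l n : nat) (nu : 'I_l -> nat).
Variable w : forall i, 'I_(nu i).+1 -> 'rV[R]_n.
Arguments w : clear implicits.
Variable T : 'I_l -> 'rV[R]_l.-1.
Hypothesis hw : factors_independent w.
Hypothesis hT : affinely_independent T.
Hypothesis T0 : \sum_i T i = 0.
Hypothesis l0 : (0 < l)%N.

(** The factor [l] compensates for the block weights 1/l prescribed by the hyperplanes; [T] sets the
    blocks apart in the extra coordinates. *)
Definition lifted (k : {i : 'I_l & 'I_(nu i).+1}) : 'rV[R]_(n + l.-1) :=
  row_mx (l%:R *: w (tag k) (tagged k)) (T (tag k)).

Lemma lifted_comb (b : {i : 'I_l & 'I_(nu i).+1} -> R) :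
  \sum_k b k *: lifted k =
  row_mx (\sum_i \sum_(j < (nu i).+1) (l%:R * b (existT _ i j)) *: w i j)
         (\sum_i (\sum_(k | tag k == i) b k) *: T i).
Proof.
have rE (I : finType) (x : I -> 'rV[R]_n) (y : I -> 'rV[R]_l.-1) :
    \sum_i row_mx (x i) (y i) = row_mx (\sum_i x i) (\sum_i y i).
  by elim/big_rec3: _ => [|i z1 z2 z3 _ ->]; rewrite ?row_mx0 ?add_row_mx.
under eq_bigr do rewrite scale_row_mx.
rewrite rE big_tagged; congr row_mx.
  by apply: eq_bigr => i _; apply: eq_bigr => j _; rewrite scalerA mulrC.
rewrite big_tagged; apply: eq_bigr => i _.
by rewrite big_tag scaler_suml.
Qed.

(** The extra coordinates force every block sum to vanish, since [T] is affinely independent;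
    independence of the factors then applies to the first [n] coordinates. *)
Lemma lifted_independent : affinely_independent lifted.
Proof.
move=> c c0 /eqP; rewrite lifted_comb row_mx_eq0 => /andP[/eqP cw /eqP cT].
have csum : \sum_i \sum_(k | tag k == i) c k = 0.
  by rewrite -[RHS]c0 [RHS](partition_big tag predT).
have ci := hT csum cT.
have l1 : l%:R != 0 :> R by rewrite pnatr_eq0 -lt0n.
move=> [i j]; apply: (mulfI l1); rewrite mulr0.
apply: (hw (c := fun i j => l%:R * c (existT _ i j)) _ cw) => k.
by rewrite -mulr_sumr -[X in _ * X](big_tag c) ci mulr0.
Qed.

(** Weights of total 1 in each factor correspond to barycentric coordinates of block sum 1/l after
    division by [l]. With these block sums the extra coordinates vanish because [T] is centred. *)
Lemma lifted_circumscribed :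
  circumscribed nu (minkowski_sum (fun i => convex_hull (w i)))
    (convex_hull lifted).
Proof.
have l1 : l%:R != 0 :> R by rewrite pnatr_eq0 -lt0n.
have lV : 0 <= l%:R^-1 :> R by rewrite invr_ge0 ler0n.
exists lifted; split => //; first exact: lifted_independent.
have sum1 (b : {i : 'I_l & 'I_(nu i).+1} -> R) :
    (forall i, \sum_(k | tag k == i) b k = l%:R^-1) -> \sum_k b k = 1.
  move=> hb; rewrite (partition_big tag predT) //=.
  under eq_bigr do rewrite hb.
  by rewrite sumr_const card_ord -[LHS]mulr_natl mulfV.
apply/seteqP; split=> z.
  move=> [x [y [hy ->]] <-].
  have [b hb] : exists b : {i : 'I_l & 'I_(nu i).+1} -> R, forall i,
      [/\ forall j : 'I_(nu i).+1, 0 <= b (existT _ i j),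
          \sum_(j < (nu i).+1) b (existT _ i j) = 1
        & y i = \sum_(j < (nu i).+1) b (existT _ i j) *: w i j].
    exists (fun k => projT1 (cid (hy (tag k))) (tagged k)) => i /=.
    exact: (projT2 (cid (hy i))).
  pose b' k := l%:R^-1 * b k.
  have b'i i : \sum_(k | tag k == i) b' k = l%:R^-1.
    by rewrite -mulr_sumr big_tag; have [_ -> _] := hb i; rewrite mulr1.
  have zE : pad l (\sum_i y i) = \sum_k b' k *: lifted k.
    rewrite lifted_comb /pad; congr row_mx; last first.
      under eq_bigr do rewrite b'i.
      by rewrite -scaler_sumr T0 scaler0.
    apply: eq_bigr => i _; have [_ _ ->] := hb i.
    by apply: eq_bigr => j _; rewrite mulVKf.
  split; last by move=> i _; exists b'; split; rewrite ?sum1.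
  exists b'; split; rewrite ?sum1 // => -[i j].
  by rewrite mulr_ge0 //; have [-> _ _] := hb i.
move=> [[b [b0 b1 zE]] hz].
(* Each hyperplane supplies its own coordinates [c]; affine independence identifies them with
   [b]. *)
have bi i : \sum_(k | tag k == i) b k = l%:R^-1.
  have [c [c1 cE <-]] := hz i I; apply: eq_bigr => k _.
  apply/eqP; rewrite -subr_eq0; apply/eqP.
  apply: (lifted_independent (c := fun k => b k - c k)).
    by rewrite sumrB b1 c1 subrr.
  under eq_bigr do rewrite scalerBl.
  by rewrite sumrB -zE -cE subrr.
exists (\sum_i \sum_(j < (nu i).+1) (l%:R * b (existT _ i j)) *: w i j).
  exists (fun i => \sum_(j < (nu i).+1) (l%:R * b (existT _ i j)) *: w i j); split => // i.
  exists (fun j => l%:R * b (existT _ i j)); split => //.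
    by move=> j; rewrite mulr_ge0.
  by rewrite -mulr_sumr -[X in _ * X](big_tag b) bi mulfV.
rewrite zE lifted_comb /pad; congr row_mx.
under eq_bigr do rewrite bi.
by rewrite -scaler_sumr T0 scaler0.
Qed.

End Circumscribed.

Lemma centered_simplex (R : realType) (l : nat) : (0 < l)%N ->
  exists T : 'I_l -> 'rV[R]_l.-1, affinely_independent T /\ \sum_i T i = 0.
Proof.
case: l => // l _ /=.
(* The standard basis vectors, together with minus their sum at index [ord0]. *)
pose T (i : 'I_l.+1) : 'rV[R]_l := \row_j ((lift ord0 j == i)%:R - (ord0 == i)%:R).
have TE (c : 'I_l.+1 -> R) j : (\sum_i c i *: T i) 0 j = c (lift ord0 j) - c ord0.
  rewrite summxE; under eq_bigr do rewrite !mxE mulrBr.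
  rewrite sumrB; congr (_ - _).
    rewrite (bigD1 (lift ord0 j)) //= eqxx mulr1 big1 ?addr0 // => i.
    by rewrite eq_sym => /negbTE ->; rewrite mulr0.
  rewrite (bigD1 ord0) //= mulr1 big1 ?addr0 // => i.
  by rewrite eq_sym => /negbTE ->; rewrite mulr0.
exists T; split; last first.
  apply/rowP => j; transitivity ((\sum_i (1 : R) *: T i) 0 j).
    by under [in RHS]eq_bigr do rewrite scale1r.
  by rewrite TE subrr mxE.
move=> c c0 cT.
have cE i : c i = c ord0.
  case: (unliftP ord0 i) => [j ->|-> //].
  by apply/eqP; rewrite -subr_eq0 -TE cT mxE.
have : c ord0 *+ l.+1 = 0.
  by rewrite -c0 (eq_bigr (fun=> c ord0)) ?sumr_const ?card_ord.
by move=> /eqP; rewrite mulrn_eq0 /= => /eqP z i; rewrite cE.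
Qed.

(** * Matching blocks and vertices *)

Lemma corner_block (R : realType) (V : lmodType R) (P Q : finType)
    (L M : eqType) (f : P -> L) (g : Q -> M) (u : P -> V) (u' : Q -> V) (h : P -> Q) :
  lin_indep u -> lin_indep u' -> corner f u = corner g u' ->
  (forall p, u' (h p) = u p) ->
  forall p q, (f p == f q) = (g (h p) == g (h q)).
Proof.
move=> hu hu' E hE p q; have [->|pq] := eqVneq p q; first by rewrite !eqxx.
have hpq : h p != h q.
  by apply: contra_neq pq => hpq; apply: (lin_indep_inj hu); rewrite -!hE hpq.
(* Lying in one block is read off the set itself, through sums of two edges. *)
have fP := corner_addP f hu pq; have gP := corner_addP g hu' hpq.
rewrite !hE -E in gP.
by apply: negb_inj; apply/idP/idP => [/fP/gP|/gP/fP].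
Qed.

(** The induced map on labels of nonempty blocks is well defined and injective; factors without
    edges are matched arbitrarily by extending it to a permutation. *)
Lemma matching_perm (P Q L : finType) (f : P -> L) (g : Q -> L) (h : P -> Q) :
  (forall p q, (f p == f q) = (g (h p) == g (h q))) ->
  exists s : {perm L}, forall p, s (f p) = g (h p).
Proof.
move=> fg.
pose F i := if [pick p | f p == i] is Some p then g (h p) else i.
have FE p : F (f p) = g (h p).
  rewrite /F; case: pickP => [q|/(_ p)]; last by rewrite eqxx.
  by rewrite fg => /eqP.
have [|s sE] := @extend_perm L [set i | i \in codom f]%SET F.
  move=> i j; rewrite !inE => /codomP[p ->] /codomP[q ->].
  by rewrite !FE => /eqP; rewrite -fg => /eqP.
by exists s => p; rewrite sE ?FE // inE codom_f.
Qed.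

Section Matching.
Variables (R : realType) (l n : nat) (nu nu' : 'I_l -> nat).
Variables (w : forall i, 'I_(nu i).+1 -> 'rV[R]_n).
Variables (w' : forall i, 'I_(nu' i).+1 -> 'rV[R]_n).
Arguments w : clear implicits.
Arguments w' : clear implicits.
Hypothesis w0 : forall i, w i ord0 = 0.
Hypothesis w'0 : forall i, w' i ord0 = 0.
Variables T T' : 'I_l -> 'rV[R]_l.-1.

Definition vertex (mu : 'I_l -> nat) (p : {i : 'I_l & 'I_(mu i)}) :
    {i : 'I_l & 'I_(mu i).+1} :=
  existT _ (tag p) (lift ord0 (tagged p)).

Lemma vertexP (mu : 'I_l -> nat) (k : {i : 'I_l & 'I_(mu i).+1}) :
  (exists i, k = existT _ i ord0) \/ exists p, k = vertex p.
Proof.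
case: k => i j; case: (unliftP ord0 j) => [j' ->|->]; last by left; exists i.
by right; exists (existT _ i j').
Qed.

(** A partial inverse of [vertex], giving its injectivity and the fact that its values are never
    origins, without dependent equalities. *)
Definition unvertex (mu : 'I_l -> nat) (k : {i : 'I_l & 'I_(mu i).+1}) :
    option {i : 'I_l & 'I_(mu i)} :=
  omap (existT (fun i => 'I_(mu i)) (tag k)) (unlift ord0 (tagged k)).

Lemma vertexK (mu : 'I_l -> nat) : pcancel (@vertex mu) (@unvertex mu).
Proof. by move=> [i j]; rewrite /unvertex /= liftK. Qed.

(** Lifted origins depend only on the translations, so they need matching values of [T] and [T'];
    the other vertices also need matching edges. *)
Lemma lifted_hull_sub (p0 : {i : 'I_l & 'I_(nu i)})
    (q0 : {i : 'I_l & 'I_(nu' i)}) :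
  (forall p, p != p0 -> exists q, [/\ q != q0, edge w' q = edge w p
                                    & T' (tag q) = T (tag p)]) ->
  (forall i, exists i', T' i' = T i) ->
  convex_hull (fun k : {k | k != vertex p0} => lifted w T (val k)) `<=`
  convex_hull (fun k : {k | k != vertex q0} => lifted w' T' (val k)).
Proof.
move=> hpq hT; apply: convex_hull_sub => -[k /= k0].
case: (vertexP k) k0 => [[i ->] _|[p ->]].
  have [i' Ti'] := hT i.
  have i'0 : existT (fun i => 'I_(nu' i).+1) i' ord0 != vertex q0.
    by apply/eqP => /(congr1 (@unvertex nu')); rewrite vertexK /unvertex /= unlift_none.
  exists (exist (fun k => k != vertex q0) _ i'0); by rewrite /lifted /= w0 w'0 Ti'.
rewrite (inj_eq (pcan_inj (@vertexK nu))) => /hpq[q [q0' qp Tq]].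
have vq : vertex q != vertex q0 by rewrite (inj_eq (pcan_inj (@vertexK nu'))).
by exists (exist (fun k => k != vertex q0) _ vq); rewrite /lifted /= Tq -/(edge w' q) qp.
Qed.

End Matching.

(** * Adjacent circumscribed simplices of two simplotopes sharing a facet *)

Theorem lemma3 (R : realType) (l n : nat) (nu nu' eps : 'I_l -> nat)
    (hnu : (\sum_i nu i)%N = n) (hnu' : (\sum_i nu' i)%N = n)
    (heps : (\sum_i eps i)%N = 1%N) (heps_nu : forall i, (eps i <= nu i)%N)
    (G G' F : set 'rV[R]_n)
    (hG : simplotope nu G) (hG' : simplotope nu' G')
    (hF : simplotope (fun i => (nu i - eps i)%N) F)
    (hFG : face F G) (hFG' : face F G') (hGG' : G `&` G' = F) :
  exists D D' E : set 'rV[R]_(n + l.-1),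
    [/\ circumscribed nu G D, circumscribed nu' G' D', D `&` D' = E
      & [/\ simplex (n + l.-1).-1 E, face E D & face E D']].
Proof.
have l0 : (0 < l)%N.
  by case: (l) eps heps {heps_nu hF} => // eps; rewrite big_ord0.
have cF : (\sum_i (nu i - eps i)).+1%N = n.
  by rewrite sumnB // hnu heps -hnu -addn1 subnK // -heps leq_sum.
case: hG hG' hF => [w [w0 hw GE]] [w' [w'0 hw' GE']] [z [z0 hz FE]].
have hu := lin_indep_edge w0 hw; have hu' := lin_indep_edge w'0 hw'.
have hz' := lin_indep_edge z0 hz.
have GC : G = corner tag (edge w) by rewrite GE minkowski_corner.
have GC' : G' = corner tag (edge w') by rewrite GE' minkowski_corner.
have FC : F = corner tag (edge z) by rewrite FE minkowski_corner.
have cP : #|{: {i & 'I_(nu i)}}| = n by rewrite card_edges.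
have cQ : #|{: {i & 'I_(nu' i)}}| = n by rewrite card_edges.
have hFGz : face (corner tag (edge z)) (corner tag (edge w)) by rewrite -FC -GC.
have hFGz' : face (corner tag (edge z)) (corner tag (edge w')) by rewrite -FC -GC'.
have cZ : #|{: {i & 'I_(nu i - eps i)}}|.+1 = n by rewrite card_edges.
have [p0 [a [ap ap0]]] := corner_facet hu hz' (etrans cP (esym cZ)) hFGz.
rewrite -FC => Fp.
(* Only the extra edge [q0] is kept: the normal [a] serves both polytopes, and [corner_opposite]
   gives its sign on [q0]. *)
have [q0 [_ [_ _]]] := corner_facet hu' hz' (etrans cQ (esym cZ)) hFGz'.
rewrite -FC => Fq.
have FE' : corner_on (fun p => p != p0) tag (edge w) =
           corner_on (fun q => q != q0) tag (edge w') by rewrite -Fp -Fq.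
have GF : corner tag (edge w) `&` corner tag (edge w') =
    corner_on (fun p => p != p0) tag (edge w) by rewrite -GC -GC' -Fp.
have aq0 := corner_opposite hu hu' cP cQ FE' GF ap ap0.
have hP := lin_indep_comp (val_inj : injective (fun p : {p | p != p0} => val p)) hu.
have hQ := lin_indep_comp (val_inj : injective (fun q : {q | q != q0} => val q)) hu'.
have [h [[k _ kK] hE]] := corner_edge_bij hP hQ FE'.
have [s sE] := matching_perm (corner_block hP hQ FE' hE).
have aq q : q != q0 -> (edge w' q *m a) 0 0 = 0.
  move=> qq; have := hE (k (exist _ q qq)); rewrite kK /= => ->.
  exact/ap/(valP (k _)).
have [T [hT T0]] := centered_simplex R l0.
(* Thus [T' (s i) = T i], so matched blocks receive the same translation. *)
pose T' := T \o (s^-1)%g.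
have hT' : affinely_independent T' by apply: affinely_independent_comp hT; apply: perm_inj.
have T'0 : \sum_i T' i = 0.
  by rewrite -[RHS]T0 [RHS](reindex_inj (@perm_inj _ s^-1)%g).
(* Extending the normal by zeros makes its values independent of the translations. *)
pose b : 'cV[R]_(n + l.-1) := col_mx a 0.
have bE mu (x : forall i, 'I_(mu i).+1 -> 'rV[R]_n) S j :
    (lifted x S j *m b) 0 0 = l%:R * (x (tag j) (tagged j) *m a) 0 0.
  by rewrite /lifted mul_row_col mulmx0 addr0 -scalemxAl mxE.
pose v0 := vertex p0; pose v0' := vertex q0.
have lR : 0 < l%:R :> R by rewrite ltr0n.
have bv j : j != v0 -> (lifted w T j *m b) 0 0 = 0.
  rewrite bE; case: (vertexP j) => [[i -> _]|[p -> pp]] /=.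
    by rewrite w0 mul0mx mxE mulr0.
  rewrite -/(edge w p) ap ?mulr0 //; by apply: contra_neq pp => ->.
have bv0 : (lifted w T v0 *m b) 0 0 < 0 by rewrite bE pmulr_rlt0.
(* The sign is reversed because the second simplex lies on the nonnegative side of [b]. *)
have bv' j : j != v0' -> (lifted w' T' j *m - b) 0 0 = 0.
  rewrite mulmxN mxE bE; case: (vertexP j) => [[i -> _]|[p -> pp]] /=.
    by rewrite w'0 mul0mx mxE mulr0 oppr0.
  rewrite -/(edge w' p) aq ?mulr0 ?oppr0 //; by apply: contra_neq pp => ->.
have bv0' : (lifted w' T' v0' *m - b) 0 0 < 0.
  by rewrite mulmxN mxE bE oppr_lt0 pmulr_rgt0.
have [Dle DE] := hull_supporting bv bv0.
have [Dle' DE'] := hull_supporting bv' bv0'.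
pose E := convex_hull (fun j : {j | j != v0} => lifted w T (val j)).
have EE : E = convex_hull (fun j : {j | j != v0'} => lifted w' T' (val j)).
  apply/seteqP; split; apply: lifted_hull_sub => //.
  - move=> p pp; exists (val (h (exist _ p pp))); split; first exact: (valP (h _)).
      exact: hE (exist _ p pp).
    by rewrite /T' /= -[X in T (_ X)](sE (exist _ p pp)) permK.
  - by move=> i; exists (s i); rewrite /T' /= permK.
  - move=> q qq; exists (val (k (exist _ q qq))); split; first exact: (valP (k _)).
      by have := hE (k (exist _ q qq)); rewrite kK => /esym.
    have := sE (k (exist _ q qq)); rewrite kK /T' /= => <-.
    by rewrite permK.
  - by move=> i; exists ((s^-1)%g i).
have E0 : E !=set0.
  have j0 : existT (fun i => 'I_(nu i).+1) (Ordinal l0) ord0 != v0.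
    by apply/eqP => /(congr1 (@unvertex _ _)); rewrite vertexK /unvertex /= unlift_none.
  exists (lifted w T (existT _ (Ordinal l0) ord0)).
  exact: (convex_hull_vertex _ (exist (fun j => j != v0) _ j0)).
exists (convex_hull (lifted w T)), (convex_hull (lifted w' T')), E; split.
- by rewrite GE; apply: lifted_circumscribed.
- by rewrite GE'; apply: lifted_circumscribed.
- apply/seteqP; split=> x.
    (* A common point has both signs for [b], hence lies on the hyperplane, which cuts the first
       simplex in [E]. *)
    move=> [xD xD']; rewrite /E DE; split => //; apply/eqP.
    rewrite eq_le Dle //=.
    by have := Dle' _ xD'; rewrite mulmxN mxE oppr_le0.
  move=> xE; split; first by move: xE; rewrite /E DE => -[].
  by move: xE; rewrite EE DE' => -[].
split.
- apply: simplex_hull.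
    exact: (affinely_independent_comp val_inj (lifted_independent hw hT l0)).
  have -> : #|{: {j | j != v0}}| = (n + l).-1.
    have -> : (n + l)%N = (\sum_i (nu i).+1)%N.
      under [RHS]eq_bigr do rewrite -addn1.
      by rewrite big_split /= hnu sum_nat_const card_ord muln1.
    by rewrite card_sig -(card_edges (fun i => (nu i).+1)) -(cardC1 v0).
  (* Positivity of [n] makes the predecessor in the dimension of [E] a true subtraction. *)
  have n0 : (0 < n)%N by rewrite -cF.
  by rewrite prednK ?addn_gt0 ?n0 // -!subn1 addnBA.
- by split => //; exists b, 0.
- by split => //; exists (- b), 0; split => //; rewrite EE.
Qed.
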